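(* For all integers $n,L,f\ge 1$ with $(L/f)^{f+1}\le n$, there exists an $n$-vertex weighted graph $G^*=(V,E,w)$ such that every $(L,f)$-replacement path covering of $G^*$ has covering value $\Omega((L/f)^f)$.
   Context: For a (possibly weighted) graph $G=(V,E)$, $s,t\in V$ and $F\subseteq E$, a replacement path $P(s,t,F)$ is a shortest $s$-$t$ path in $G\setminus F$. A subgraph $G'\subseteq G$ covers $P(s,t,F)$ if $P(s,t,F)\subseteq G'$ and $F\cap E(G')=\emptyset$. A collection $\mathcal{G}$ of subgraphs of $G$ is an $(L,f)$-replacement path covering if for every $s,t\in V$ and every $F\subseteq E$ with $|F|\le f$, each replacement path $P(s,t,F)$ with at most $L$ edges is covered by some subgraph in $\mathcal{G}$ (if there are several $s$-$t$ shortest paths in $G\setminus F$ with at most $L$ edges, it suffices to cover one of them). Its covering value is $|\mathcal{G}|$. *)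

(* Defs.v *)
From HB Require Import structures.
From mathcomp Require Import all_boot all_order all_algebra.
From mathcomp Require Import reals.

Set Implicit Arguments.
Unset Strict Implicit.
Unset Printing Implicit Defensive.

Import Order.TTheory GRing.Theory Num.Theory.
Local Open Scope ring_scope.

(* An edge is a two-element set of vertices: graphs are finite, undirected,
   loopless and without parallel edges.  Values of [weight] outside [edges]
   are never used. *)
Record wgraph (R : realType) := WGraph {
  vertex : finType;
  edges : {set {set vertex}};
  edges_card2 : forall e, e \in edges -> #|e| = 2%N;
  weight : {set vertex} -> R;
  weight_gt0 : forall e, e \in edges -> 0 < weight e
}.

(* A path from [s] is given by the sequence [p] of its vertices after [s],
   so that [size p] is its number of edges. *)
Definition path_edges (V : finType) (s : V) (p : seq V) : seq {set V} :=
  pairmap (fun x y => [set x; y]) s p.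

Definition is_path (V : finType) (E : {set {set V}}) (s t : V) (p : seq V) : bool :=
  [&& path (fun x y => [set x; y] \in E) s p, uniq (s :: p) & last s p == t].

Definition path_weight (R : realType) (G : wgraph R) (s : vertex G)
    (p : seq (vertex G)) : R :=
  \sum_(e <- path_edges s p) weight e.

Definition replacement_path (R : realType) (G : wgraph R) (s t : vertex G)
    (F : {set {set vertex G}}) (p : seq (vertex G)) : Prop :=
  is_path (edges G :\: F) s t p /\
  forall q, is_path (edges G :\: F) s t q -> path_weight s p <= path_weight s q.

(* Pairs (vertex set, edge set); see [is_subgraph] for well-formedness. *)
Definition subgraph_of (R : realType) (G : wgraph R) : finType :=
  ({set vertex G} * {set {set vertex G}})%type.

Definition is_subgraph (R : realType) (G : wgraph R) (H : subgraph_of G) : Prop :=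
  H.2 \subset edges G /\ forall e, e \in H.2 -> e \subset H.1.

Definition covers (R : realType) (G : wgraph R) (H : subgraph_of G)
    (s : vertex G) (p : seq (vertex G)) (F : {set {set vertex G}}) : Prop :=
  [/\ {subset s :: p <= H.1}, {subset path_edges s p <= H.2} & F :&: H.2 = set0].

(* When several shortest paths with at most [L] edges exist, covering one of
   them suffices. *)
Definition replacement_path_covering (R : realType) (L f : nat) (G : wgraph R)
    (C : {set subgraph_of G}) : Prop :=
  (forall H, H \in C -> is_subgraph H) /\
  forall (s t : vertex G) (F : {set {set vertex G}}),
    F \subset edges G -> (#|F| <= f)%N ->
    (exists p, replacement_path s t F p /\ (size p <= L)%N) ->
    exists p H, [/\ replacement_path s t F p, (size p <= L)%N, H \in C
                  & covers H s p F].

(* Main.v *)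
Require Import Defs.
From HB Require Import structures.
From mathcomp Require Import all_boot all_order all_algebra.
From mathcomp Require Import zify.
From mathcomp Require Import reals.

Import Order.TTheory GRing.Theory Num.Theory.
Local Open Scope ring_scope.

(* The graph is an unweighted full binary tree, padded with isolated vertices,
   whose leaves are binary words of length at most [L] with at most [f] letters
   [true].  For a leaf [v], fail the [false] edge at every vertex where the path
   from the root to [v] takes the [true] edge: at most [f] faults, and that path
   survives.  Two leaves separate at some vertex [u]; one takes the [true] edge,
   so the [false] edge at [u] is a fault for it, while that same edge is a bridge
   that any path from the root to the other leaf must use.  Hence no subgraph
   serves two leaves, and a covering has at least as many members as there are
   leaves.  A full binary tree has one leaf more than internal vertices, and the
   internal vertices can be any prefix-closed set of words of length less than
   [L] with fewer than [f] letters [true].  So one can have about [n / 2] leaves,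
   or ['C(L, f) >= (L / f) ^ f] of them if [n] is larger. *)

(** * Binomial bounds and prefix-closed sets of words *)

Lemma expn_ffact_le (L f k : nat) :
  (k <= f)%N -> (f <= L)%N -> (L ^ k * f ^_ k <= L ^_ k * f ^ k)%N.
Proof.
move=> + fL; elim: k => [|k IHk] kf //.
rewrite !expnSr !ffactnSr mulnACA [leqRHS]mulnACA.
(* The new factors satisfy [L * (f - k) <= (L - k) * f], since [f <= L]. *)
by apply: leq_mul; [apply: IHk; lia | nia].
Qed.

Lemma expn_bin_le (L f : nat) : (f <= L)%N -> (L ^ f <= 'C(L, f) * f ^ f)%N.
Proof.
move=> fL; rewrite -(leq_pmul2r (fact_gt0 f)) mulnAC bin_ffact -ffactnn.
exact: expn_ffact_le.
Qed.

(** Pascal's rule: below the empty word, the [false] branch keeps the allowance of letters [true]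
    and the [true] branch spends one. *)
Lemma prefix_closed_words (L f M : nat) : (M <= 'C(L, f).-1)%N ->
  exists I : seq (seq bool),
    [/\ uniq I, size I = M,
        forall u b, rcons u b \in I -> u \in I &
        forall u, u \in I -> (size u < L)%N /\ (count id u < f)%N].
Proof.
elim: L f M => [|L IHL] [|f] [|M] //; try by exists [::].
rewrite binS => leM.
pose M1 := minn M 'C(L, f.+1).-1.
have [I1 [uI1 sI1 cI1 bI1]] := IHL f.+1 M1 (geq_minr _ _).
have [|I2 [uI2 sI2 cI2 bI2]] := IHL f (M - M1)%N; first by rewrite /M1; lia.
have inj b : injective (cons b : seq bool -> seq bool) by move=> x y [].
pose I := [::] :: map (cons false) I1 ++ map (cons true) I2.
have inI b u : (b :: u \in I) = (u \in if b then I2 else I1).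
  rewrite in_cons mem_cat /=; case: b.
    rewrite (mem_map (inj true)) orb_idl //.
    by move/mapP => [? _ []].
  rewrite (mem_map (inj false)) orb_idr //.
  by move/mapP => [? _ []].
exists I; split.
- rewrite /= cat_uniq !map_inj_uniq // uI1 uI2 /= andbT mem_cat negb_or.
  apply/andP; split; first by apply/andP; split; apply/mapP => -[].
  by apply/hasPn => _ /mapP[u _ ->]; apply/mapP => -[].
- by rewrite /= size_cat !size_map sI1 sI2 /M1; lia.
- case=> [|[] u] b; rewrite ?mem_head // rcons_cons !inI.
    exact: cI2.
  exact: cI1.
- case=> [|[] u] //; rewrite inI /=.
    by case/bI2 => lt1 lt2; split; rewrite ?add1n ltnS.
  by case/bI1 => lt1 lt2; split; rewrite ?add0n ?ltnS.
Qed.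

(** * Prefixes, cut crossings, counting and shortest paths *)

Lemma incomparable_split (v w : seq bool) :
  ~~ prefix v w -> ~~ prefix w v ->
  exists u b, prefix (rcons u b) v /\ prefix (rcons u (~~ b)) w.
Proof.
elim: v w => [|a v IHv] [|c w] //=.
have [<-|ac] := eqVneq a c; last first.
  move=> _ _; exists [::], a; split=> /=.
    by rewrite eqxx prefix0s.
  by move: ac; case: a; case: c; rewrite //= ?prefix0s.
rewrite ?eqxx /= => nvw nwv; have [u [b [uv uw]]] := IHv w nvw nwv.
by exists (a :: u), b; rewrite !rcons_cons /= !eqxx.
Qed.

Lemma prefix_of_rcons (T : eqType) (s t : seq T) (x : T) :
  prefix s (rcons t x) = (s == rcons t x) || prefix s t.
Proof.
elim: t s => [|y t IHt] [|z s] //=; first by rewrite eqseq_cons orbF; case: s.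
by rewrite IHt eqseq_cons -andb_orr.
Qed.

Lemma path_crossing (V : finType) (S : pred V) (s : V) (p : seq V) (e : rel V) :
  path e s p -> ~~ S s -> S (last s p) ->
  exists x y, [/\ ~~ S x, S y, e x y & [set x; y] \in path_edges s p].
Proof.
elim: p s => [|y p IHp] s /=; first by move=> _ /negP.
move=> /andP[esy yp] Ss Sl; have [Sy|Sy] := boolP (S y).
  by exists s, y; rewrite mem_head.
have [x [z [Sx Sz exz xzp]]] := IHp y yp Sy Sl.
by exists x, z; rewrite in_cons xzp orbT.
Qed.

(** The member of [C] found for the head cannot serve the tail, so it is removed and the induction
    goes on. A relation [Q] avoids choosing a function from [s] to [C]. *)
Lemma size_le_card_cover (T : eqType) (K : finType) (Q : T -> K -> Prop)
    (s : seq T) (C : {set K}) : uniq s ->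
  {in s &, forall v w H, Q v H -> Q w H -> v = w} ->
  (forall v, v \in s -> exists2 H, H \in C & Q v H) ->
  (size s <= #|C|)%N.
Proof.
elim: s C => [|v s IHs] C //= /andP[vs us] Qinj Qex.
have [H HC QvH] := Qex v (mem_head _ _).
rewrite (cardsD1 H) HC; apply: IHs => // [x y xs ys|w ws].
  by apply: Qinj; rewrite in_cons ?xs ?ys orbT.
have [|K' K'C QwK] := Qex w; first by rewrite in_cons ws orbT.
exists K' => //; rewrite !inE K'C andbT.
apply: contraNneq vs => K'H.
rewrite (Qinj v w _ _ H) ?mem_head //; last by rewrite -K'H.
by rewrite in_cons ws orbT.
Qed.

Lemma replacement_path_exists (R : realType) (G : wgraph R) (s t : vertex G)
    (F : {set {set vertex G}}) (p : seq (vertex G)) :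
  (forall e : {set vertex G}, weight e = 1) ->
  path (fun x y => [set x; y] \in edges G :\: F) s p -> last s p = t ->
  exists q, replacement_path s t F q /\ (size q <= size p)%N.
Proof.
move=> w1.
have pw q : path_weight s q = (size q)%:R :> R.
  rewrite /path_weight (eq_bigr (fun=> 1)) // big_const_seq count_predT.
  by rewrite size_pairmap iter_addr_0.
case/shortenP => p' pp' up' sp' lt.
have szp' : (size p' <= size p)%N by apply: uniq_leq_size => //; case/andP: up'.
(* With unit weights, weight is length, so it suffices to minimise a natural number. Tuples make [P]
   decidable. *)
pose P k := [exists q : k.-tuple (vertex G), is_path (edges G :\: F) s t q].
have exP : exists k, P k.
  exists (size p'); apply/existsP; exists (in_tuple p').
  by rewrite /is_path pp' up' lt eqxx.
case: (ex_minnP exP) => k /existsP[q qP] kmin.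
exists q; split; last first.
  rewrite size_tuple (leq_trans _ szp') // kmin //; apply/existsP.
  by exists (in_tuple p'); rewrite /is_path pp' up' lt eqxx.
split=> // r rP; rewrite !pw ler_nat size_tuple kmin //.
by apply/existsP; exists (in_tuple r).
Qed.

(** * The tree with internal vertices [I], and its fault sets *)

Section WordTree.

Variables (R : realType) (n : nat) (I : seq (seq bool)).
Hypotheses (uniqI : uniq I) (sizeI : (2 * size I < n.+1)%N).
Hypothesis closedI : forall u b, rcons u b \in I -> u \in I.

(** Every word of [I] contributes both children, so the tree is full. The root is listed apart and
    is present even if [I] is empty. *)
Definition nodes : seq (seq bool) :=
  [::] :: [seq rcons u b | u <- I, b <- [:: false; true]].

Definition leaves : seq (seq bool) := [seq v <- nodes | v \notin I].

Definition node_vertex (v : seq bool) : 'I_n.+1 := inord (index v nodes).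

(* Isolated vertices are sent to the root word [::]. *)
Definition vertex_node (x : 'I_n.+1) : seq bool := nth [::] nodes x.

Definition tree_edge (u : seq bool) (b : bool) : {set 'I_n.+1} :=
  [set node_vertex u; node_vertex (rcons u b)].

Definition tree_edges : {set {set 'I_n.+1}} :=
  [set e in [seq tree_edge u b | u <- I, b <- [:: false; true]]].

(* The fault set of [v] closes the [false] branch wherever [v] takes the [true]
   one. *)
Definition faults (v : seq bool) : {set {set 'I_n.+1}} :=
  [set e in [seq tree_edge (take k v) false
            | k <- [seq k <- iota 0 (size v) | nth false v k]]].

Lemma size_nodes : size nodes = (2 * size I).+1.
Proof. by rewrite mulnC -(size_allpairs (@rcons bool) I [:: false; true]). Qed.

Lemma uniq_nodes : uniq nodes.
Proof.
rewrite cons_uniq allpairs_uniq //; last first.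
  by case=> [u b] [v c] _ _ /= /rcons_inj[-> ->].
rewrite andbT; apply/allpairsP => -[[u b] [_ _ /= /(congr1 size)]].
by rewrite size_rcons.
Qed.

Lemma rcons_nodes u b : (rcons u b \in nodes) = (u \in I).
Proof.
rewrite in_cons -size_eq0 size_rcons orFb.
apply/allpairsP/idP => [[[v c] [vI _ /= /rcons_inj[-> _]]] // | uI].
by exists (u, b); split=> //; case: b.
Qed.

Lemma mem_nodes u : u \in I -> u \in nodes.
Proof.
case/lastP: u => [_|u b /closedI]; first exact: mem_head.
by rewrite rcons_nodes.
Qed.

Lemma cat_nodes u b v : u ++ b :: v \in nodes -> u \in I.
Proof.
elim/last_ind: v => [|v c IHv]; first by rewrite cats1 rcons_nodes.
by rewrite -rcons_cons -rcons_cat rcons_nodes => /mem_nodes.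
Qed.

Lemma uniq_leaves : uniq leaves.
Proof. exact/filter_uniq/uniq_nodes. Qed.

(** Of the [2 * size I + 1] nodes, exactly [size I] are internal. *)
Lemma size_leaves : size leaves = (size I).+1.
Proof.
have := count_predC (mem I) nodes; rewrite size_nodes -size_filter.
have -> : size [seq v <- nodes | mem I v] = size I.
  apply/perm_size/uniq_perm => //; first exact/filter_uniq/uniq_nodes.
  by move=> v; rewrite mem_filter andb_idr //; apply: mem_nodes.
by rewrite size_filter => E; apply: (@addnI (size I)); rewrite E addnS mul2n addnn.
Qed.

Lemma node_vertexK : {in nodes, cancel node_vertex vertex_node}.
Proof.
move=> v vW; rewrite /vertex_node inordK ?nth_index //.
by rewrite (leq_trans _ sizeI) // ltnS -ltnS -size_nodes index_mem.
Qed.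

Lemma tree_edgesP e :
  reflect (exists u b, u \in I /\ e = tree_edge u b) (e \in tree_edges).
Proof.
rewrite inE; apply: (iffP allpairsP) => [[[u b] [uI _ ->]]|[u [b [uI ->]]]].
  by exists u, b.
by exists (u, b); split=> //; case: b.
Qed.

Lemma card_tree_edge e : e \in tree_edges -> #|e| = 2%N.
Proof.
case/tree_edgesP => u [b [uI ->]]; rewrite cards2.
case: eqVneq => // /(congr1 vertex_node).
rewrite !node_vertexK ?rcons_nodes ?mem_nodes // => /(congr1 size).
by rewrite size_rcons; lia.
Qed.

Lemma set2_eq (T : finType) (a b c d : T) :
  [set a; b] = [set c; d] -> a = c /\ b = d \/ a = d /\ b = c.
Proof.
move=> E.
have: a \in [set c; d] by rewrite -E set21.
have: b \in [set c; d] by rewrite -E set22.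
have: c \in [set a; b] by rewrite E set21.
have: d \in [set a; b] by rewrite E set22.
rewrite !inE.
by do 4 (case/orP=> /eqP ?); subst; auto.
Qed.

Lemma tree_edge_inj u v b c : u \in I -> v \in I ->
  tree_edge u b = tree_edge v c -> u = v /\ b = c.
Proof.
move=> uI vI /set2_eq[] [] /(congr1 vertex_node) + /(congr1 vertex_node);
  rewrite !node_vertexK ?rcons_nodes ?mem_nodes //.
  by move=> -> /rcons_inj[].
(* Crossed endpoints would make each of [u] and [v] a child of the other. *)
move=> /(congr1 size) + /(congr1 size); rewrite !size_rcons; lia.
Qed.

Lemma card_faults v : (#|faults v| <= count id v)%N.
Proof.
rewrite cardsE (leq_trans (card_size _)) // size_map size_filter.
by rewrite -{3}(mkseq_nth false v) /mkseq count_map.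
Qed.

Lemma faultsP v e : reflect
  (exists2 u, prefix (rcons u true) v & e = tree_edge u false) (e \in faults v).
Proof.
rewrite inE; apply: (iffP mapP) => [[k]|[u /prefixP[w ->] ->]].
  rewrite mem_filter mem_iota /= => /andP[vk kv] ->; exists (take k v) => //.
  by rewrite -[true]vk -take_nth // prefix_take.
exists (size u); last by rewrite cat_rcons take_size_cat.
rewrite mem_filter mem_iota /= cat_rcons nth_cat ltnn subnn /=.
by rewrite size_cat /=; lia.
Qed.

Lemma faults_sub v : v \in nodes -> faults v \subset tree_edges.
Proof.
move=> vW; apply/subsetP => e /faultsP[u /prefixP[w vE] ->].
apply/tree_edgesP; exists u, false; split=> //.
by move: vW; rewrite vE cat_rcons => /cat_nodes.
Qed.

(* The vertices below [rcons u b] are entered through the edge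
   [tree_edge u b] only. *)
Lemma path_tree_edge p u b v : v \in nodes -> prefix (rcons u b) v ->
  path (fun x y => [set x; y] \in tree_edges) (node_vertex [::]) p ->
  last (node_vertex [::]) p = node_vertex v ->
  tree_edge u b \in path_edges (node_vertex [::]) p.
Proof.
move=> vW uv pP lastp; pose S x := prefix (rcons u b) (vertex_node x).
have [||x [y [Sx Sy]]] := path_crossing _ S _ _ _ pP.
- by rewrite /S node_vertexK ?mem_head // prefixs0 -size_eq0 size_rcons.
- by rewrite /S lastp node_vertexK.
case/tree_edgesP => a [c [aI E]]; rewrite E.
suff [-> ->] : u = a /\ b = c by [].
(* The crossing step cannot go towards the root: a child of a vertex below [rcons u b] is itself
   below it. *)
move: Sx Sy; rewrite /S; case/set2_eq: E => -[-> ->];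
  rewrite !node_vertexK ?rcons_nodes ?mem_nodes //.
- move=> nua; by rewrite prefix_of_rcons (negPf nua) orbF => /eqP/rcons_inj[].
- move=> nuac uac; case/negP: nuac.
  by rewrite prefix_of_rcons uac orbT.
Qed.

Fixpoint descent (u v : seq bool) : seq 'I_n.+1 :=
  if v is b :: v' then node_vertex (rcons u b) :: descent (rcons u b) v'
  else [::].

Lemma size_descent u v : size (descent u v) = size v.
Proof. by elim: v u => //= b v IHv u; rewrite IHv. Qed.

Lemma last_descent u v :
  last (node_vertex u) (descent u v) = node_vertex (u ++ v).
Proof. by elim: v u => [|b v IHv] u /=; rewrite ?cats0 // IHv cat_rcons. Qed.

(** If an edge of the descent were a fault, [w] would have both letters [false] and [true] at
    position [size u]. *)
Lemma path_descent u v w : w = u ++ v -> w \in nodes ->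
  path (fun x y => [set x; y] \in tree_edges :\: faults w)
    (node_vertex u) (descent u v).
Proof.
move=> + wW; elim: v u => [|b v IHv] u //= wE.
have uI : u \in I by apply: (@cat_nodes u b v); rewrite -wE.
rewrite IHv ?cat_rcons // andbT inE; apply/andP; split; last first.
  by apply/tree_edgesP; exists u, b.
apply/faultsP => -[a /prefixP[x wE']].
have aI : a \in I by apply: (@cat_nodes a true x); rewrite -cat_rcons -wE'.
case/(tree_edge_inj _ _ _ _ uI aI) => ua bf.
move/(congr1 (nth false ^~ (size u))): wE; rewrite wE' cat_rcons -ua bf.
by rewrite !nth_cat ltnn subnn.
Qed.

(** * Distinct leaves need distinct members of a covering *)

Definition tree_graph : wgraph R :=
  @WGraph R 'I_n.+1 tree_edges card_tree_edge (fun=> 1) (fun _ _ => ltr01).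

Lemma leaves_prefix v w : v \in leaves -> w \in leaves -> v != w ->
  ~~ prefix v w.
Proof.
rewrite !mem_filter => /andP[vI _] /andP[_ wW] vw.
apply/negP => /prefixP[[|b x] wE]; first by rewrite wE cats0 eqxx in vw.
by case/negP: vI; apply: (@cat_nodes v b x); rewrite -wE.
Qed.

Lemma size_leaves_le_covering L f (C : {set subgraph_of tree_graph}) :
  {in nodes, forall v, (size v <= L)%N /\ (count id v <= f)%N} ->
  replacement_path_covering L f C -> (size leaves <= #|C|)%N.
Proof.
move=> bW [_ cov].
pose Q v (H : subgraph_of tree_graph) := exists p,
  replacement_path (G := tree_graph) (node_vertex [::]) (node_vertex v)
    (faults v) p /\
  covers (G := tree_graph) H (node_vertex [::]) p (faults v).
have leafW v : v \in leaves -> v \in nodes by rewrite mem_filter => /andP[].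
(* [H] must avoid the [false] edge at [u] for [v], yet contain it for [w]. *)
have noQ v w u H : w \in leaves -> prefix (rcons u true) v ->
    prefix (rcons u false) w -> Q v H -> Q w H -> False.
  move=> wl uv uw [_ [_ [_ _ vH]]] [q [[/and3P[pq _ /eqP lq] _] [_ qH _]]].
  have wq : tree_edge u false \in path_edges (node_vertex [::]) q.
    apply: (path_tree_edge q u false w) => //; first exact: leafW.
    by apply: sub_path pq => x y /setDP[].
  have := in_set0 (tree_edge u false); rewrite -vH inE (qH _ wq) andbT.
  by move/negP; apply; apply/faultsP; exists u.
apply: (@size_le_card_cover _ _ Q) => [|v w vl wl H|v vl].
- exact: uniq_leaves.
- move=> Qv Qw; apply/eqP; apply: contraT => vw.
  have [|u [[] [uv uw]]] := incomparable_split v w (leaves_prefix v w vl wl vw).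
  + by apply: leaves_prefix; rewrite // eq_sym.
  + by case: (noQ v w u H wl uv uw Qv Qw).
  + by case: (noQ w v u H vl uw uv Qw Qv).
- have [sv fv] := bW v (leafW v vl).
  have [|p [H [pP _ HC Hp]]] := cov (node_vertex [::]) (node_vertex v)
    (faults v) (faults_sub v (leafW v vl)) (leq_trans (card_faults v) fv).
    (* The descent to [v] has [size v <= L] edges, so some replacement path is short enough to
       require covering. *)
    have [|||p [pP sp]] := replacement_path_exists R tree_graph (node_vertex [::])
      (node_vertex v) (faults v) (descent [::] v).
    + by [].
    + exact/path_descent/leafW.
    + exact: last_descent.
    by exists p; split=> //; rewrite (leq_trans sp) // size_descent.
  by exists H => //; exists p.
Qed.

End WordTree.

(** * Choice of the tree size and of the constant *)

Theorem theorem1p3 (R : realType) :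
  exists c : R, 0 < c /\
    forall n L f : nat, (1 <= n)%N -> (1 <= L)%N -> (1 <= f)%N ->
      (L%:R / f%:R : R) ^+ f.+1 <= n%:R ->
      exists G : wgraph R, #|vertex G| = n /\
        forall C : {set subgraph_of G},
          replacement_path_covering L f C ->
          c * (L%:R / f%:R) ^+ f <= #|C|%:R.
Proof.
exists 2^-1; split; first by rewrite invr_gt0 ltr0n.
case=> // n L f _ L_gt0 f_gt0 leLn.
(* There are now [n.+1] vertices, and the tree takes [2 * M + 1] of them. *)
pose M := minn n./2 'C(L, f).-1.
have [I [uI sI cI bI]] := prefix_closed_words L f M (geq_minr _ _).
have sI2 : (2 * size I < n.+1)%N by rewrite sI /M; lia.
exists (tree_graph R n I uI sI2 cI); split; first exact: card_ord.
move=> C covC.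
have bW : {in nodes I, forall v, (size v <= L)%N /\ (count id v <= f)%N}.
  move=> v; case/lastP: v => [|v b] //; rewrite rcons_nodes // => /bI[sv cv].
  rewrite size_rcons -cats1 count_cat /=; split=> //.
  by case: b; lia.
have := size_leaves_le_covering R n I uI sI2 cI L f C bW covC.
rewrite size_leaves // sI -(ler_nat R); apply: le_trans.
have f_gt0R : 0 < f%:R :> R by rewrite ltr0n.
have x_ge0 : 0 <= L%:R / f%:R :> R by rewrite divr_ge0 ?ler0n.
rewrite mulrC ler_pdivrMr ?ltr0n // -natrM.
(* If [L < f], the power is at most 1 and a single leaf suffices. *)
have [fL|Lf] := leqP f L; last first.
  rewrite (@le_trans _ _ 1) ?ler1n ?muln_gt0 //.
  by rewrite exprn_ile1 // ler_pdivrMr // mul1r ler_nat ltnW.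
have x_ge1 : 1 <= L%:R / f%:R :> R by rewrite ler_pdivlMr // mul1r ler_nat.
(* If the vertex count limits the tree, [(L / f) ^ f <= (L / f) ^ f.+1 <= n.+1], at most twice the
   number of leaves: hence the constant 1/2. Otherwise there are ['C(L, f)] leaves. *)
have [le_n|lt_n] := leqP n./2 'C(L, f).-1.
  apply: (@le_trans _ _ n.+1%:R).
    apply: le_trans leLn; rewrite exprSr ler_peMr // exprn_ge0 //.
  by rewrite ler_nat /M; lia.
apply: (@le_trans _ _ 'C(L, f)%:R); last by rewrite ler_nat /M; lia.
by rewrite expr_div_n ler_pdivrMr ?exprn_gt0 // -!natrX -natrM ler_nat expn_bin_le.
Qed.
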